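(* For a positive integer $N$, let $H_3(N)$ be the number of tuples $(a_0,a_1,a_2,a_3)$ of integers with $0\le a_0\le N$, $1\le a_i\le N$ for $i=1,2,3$, $\gcd(a_0,a_1,a_2,a_3)=1$, and $H(a_0;a_1,a_2,a_3)\subset\mathcal{S}$. Then $H_3(N)\gg N^{1/8}$, i.e. there exist constants $c>0$ and $N_0$ such that $H_3(N)\ge c\,N^{1/8}$ for all $N\ge N_0$.
   Context: $\mathcal{S}=\{n^2 : n\in\mathbb{N}\}$ is the set of integer squares ($\mathbb{N}$ contains $0$). The Hilbert cube of dimension $3$ is $H(a_0;a_1,a_2,a_3)=\{a_0+\varepsilon_1a_1+\varepsilon_2a_2+\varepsilon_3a_3 : \varepsilon_i\in\{0,1\}\}$. A Hilbert cube is called reduced if $\gcd(a_0,a_1,a_2,a_3)=1$. *)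

(* Defs.v *)
From mathcomp Require Import all_boot all_order all_algebra.
From mathcomp Require Import all_classical all_reals all_analysis.

Set Implicit Arguments.
Unset Strict Implicit.
Unset Printing Implicit Defensive.

Local Open Scope classical_set_scope.
Local Open Scope nat_scope.

Definition squares : set nat := [set n ^ 2 | n in [set: nat]].

(* Only nonnegative a_0, a_1, ..., a_d are considered below, so the cube is a
   set of natural numbers; the booleans eps i are coerced to 0 or 1. *)
Definition hilbert_cube (d : nat) (a0 : nat) (a : 'I_d -> nat) : set nat :=
  [set a0 + \sum_(i < d) eps i * a i | eps in [set: 'I_d -> bool]].

Definition reduced (d : nat) (a0 : nat) (a : 'I_d -> nat) : bool :=
  gcdn a0 (\big[gcdn/0]_(i < d) a i) == 1.

(* The integers between 0 and N are the elements of 'I_N.+1. *)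
Definition Hcount (d N : nat) : nat :=
  #|[pred t : 'I_N.+1 * {ffun 'I_d -> 'I_N.+1} |
      [&& [forall i : 'I_d, 1 <= t.2 i],
          reduced t.1 (fun i => t.2 i) &
          `[< hilbert_cube t.1 (fun i => t.2 i) `<=` squares >]]]|.

(* Main.v *)
(* If p > q generate the Pythagorean triple (x, y, z) = (2pq, p^2 - q^2, z), then
   (x - y)^2, z^2, (x + y)^2 is an arithmetic progression of squares with
   difference 4pq(p^2 - q^2), which is four times the area of the triangle.  The
   triangles generated by (k^2 + k + 1, 2k + 1) and (k^2 + 2k, k^2 + k + 1) have
   the same area, so their two progressions form a 3-dimensional cube with a_1 = a_2 = a
   the common difference and a_3 = b the shift between them.  For 6 | k the second
   triangle is primitive, which makes the cube reduced.  The entries have degree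
   at most 8 in k, whence N^(1/8). *)
Require Import Defs.
From mathcomp Require Import all_boot all_order all_algebra.
From mathcomp Require Import all_classical all_reals all_analysis.
From mathcomp Require Import ring zify.

Set Implicit Arguments.
Unset Strict Implicit.
Unset Printing Implicit Defensive.

Import Order.TTheory GRing.Theory Num.Theory.
Local Open Scope ring_scope.

Section Family.
Local Open Scope nat_scope.

(* The parameter is t = k - 6, so that no truncated subtraction occurs: [root_a0 t]
   is k^4 - 2k^3 - 7k^2 - 8k - 2, and t + 5 is k - 1. *)
Definition root_a0 (t : nat) := t ^ 4 + 22 * t ^ 3 + 173 * t ^ 2 + 556 * t + 562.

Definition common_step (t : nat) :=
  let k := t + 6 in
  4 * (k ^ 2 + k + 1) * (2 * k + 1) * k * (t + 5) * (k + 1) * (k + 2).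

Definition hyp1 (t : nat) :=
  let k := t + 6 in (k ^ 2 + k + 1) ^ 2 + (2 * k + 1) ^ 2.

Definition hyp2 (t : nat) :=
  let k := t + 6 in (k ^ 2 + 2 * k) ^ 2 + (k ^ 2 + k + 1) ^ 2.

(** This is [hyp2 t ^ 2 - hyp1 t ^ 2], factored as difference times sum so that no subtraction
    appears. *)
Definition shift_step (t : nat) :=
  let k := t + 6 in
  (t + 5) * (k + 1) * (k ^ 2 + 4 * k + 1) * (hyp1 t + hyp2 t).

(** Leg difference of the second triangle, as [root_a0] is that of the first. [root_max1] and
    [root_max2] are the two leg sums; in the latter [2 * t + 11] is 2k - 1. *)
Definition root_shifted (t : nat) :=
  let k := t + 6 in 2 * k ^ 4 + 4 * k ^ 3 + 5 * k ^ 2 + 6 * k + 1.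

Definition root_max1 (t : nat) :=
  let k := t + 6 in k ^ 4 + 6 * k ^ 3 + 5 * k ^ 2 + 4 * k + 2.

Definition root_max2 (t : nat) :=
  let k := t + 6 in 2 * k ^ 4 + 8 * k ^ 3 + 7 * k ^ 2 + 2 * t + 11.

Lemma root_a0_step t : root_a0 t ^ 2 + common_step t = hyp1 t ^ 2.
Proof. by rewrite /root_a0 /common_step /hyp1; ring. Qed.

Lemma root_a0_step2 t : root_a0 t ^ 2 + 2 * common_step t = root_max1 t ^ 2.
Proof. by rewrite /root_a0 /common_step /root_max1; ring. Qed.

Lemma root_a0_shift t : root_a0 t ^ 2 + shift_step t = root_shifted t ^ 2.
Proof. by rewrite /root_a0 /shift_step /hyp1 /hyp2 /root_shifted; ring. Qed.

Lemma root_shifted_step t : root_shifted t ^ 2 + common_step t = hyp2 t ^ 2.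
Proof. by rewrite /common_step /hyp2 /root_shifted; ring. Qed.

Lemma root_shifted_step2 t :
  root_shifted t ^ 2 + 2 * common_step t = root_max2 t ^ 2.
Proof. by rewrite /common_step /root_max2 /root_shifted; ring. Qed.

(** Here w = 2pq - (p^2 - q^2) is odd, so a common prime l is odd. If l divides p or q, the equation
    for w makes it divide both; if l divides p^2 - q^2, it divides 2pq, hence p or q. Either way
    coprimality fails. *)
Lemma coprime_pythagorean p q w : coprime p q -> odd (p + q) -> q <= p ->
  w + p ^ 2 = q ^ 2 + 2 * p * q -> coprime w (4 * p * q * (p - q) * (p + q)).
Proof.
move=> cpq odd_pq le_qp def_w; rewrite /coprime eqn_leq gcdn_gt0.
have p_gt0 : 0 < p by case: p {cpq def_w} le_qp odd_pq => //; case: q.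
have w_odd : odd w.
  have := congr1 odd def_w.
  rewrite !oddD !oddX !oddM /=; move: odd_pq; rewrite oddD.
  by case: (odd w); case: (odd p); case: (odd q).
rewrite [0 < w]odd_gt0 // andbT leqNgt; apply/negP => g_gt1.
have [l l_pr /andP[lw la]] : exists2 l, prime l &
    (l %| w) && (l %| 4 * p * q * (p - q) * (p + q)).
  by exists (pdiv (gcdn w (4 * p * q * (p - q) * (p + q))));
    rewrite ?pdiv_prime // -dvdn_gcd pdiv_dvd.
have l_neq2 : l %| 2 -> False.
  by rewrite dvdn_prime2 // => /eqP l2; move: lw; rewrite l2 dvdn2 w_odd.
have not_both : l %| p -> l %| q -> False.
  move=> lp lq; have: l %| gcdn p q by rewrite dvdn_gcd lp.
  by rewrite (eqP cpq) dvdn1 => /eqP l1; rewrite l1 in l_pr.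
have lpq2 : l %| p ^ 2 -> l %| q ^ 2 + 2 * p * q.
  by move=> ?; rewrite -def_w dvdn_add.
have lX x : l %| x ^ 2 -> l %| x by rewrite Euclid_dvdX // => /andP[].
have l_p_q : l %| p -> l %| q.
  move=> lp; apply: lX; rewrite -(@dvdn_addl (2 * p * q)).
    by apply: lpq2; apply: dvdn_exp.
  by rewrite mulnAC dvdn_mull.
have l_q_p : l %| q -> l %| p.
  move=> lq; apply: lX; rewrite -(@dvdn_addr w) // def_w.
  by rewrite dvdn_add ?dvdn_exp ?dvdn_mull.
have p_l : ~~ (l %| p) by apply/negP => lp; exact: not_both (l_p_q lp).
have q_l : ~~ (l %| q) by apply/negP => lq; exact: not_both (l_q_p lq) lq.
have l_sq : l %| p ^ 2 - q ^ 2 -> False.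
  move=> lpq; have : l %| 2 * p * q.
    have -> : 2 * p * q = w + (p ^ 2 - q ^ 2).
      by rewrite addnBA ?leq_exp2r // def_w addKn.
    by rewrite dvdn_add.
  by rewrite !Euclid_dvdM // (negPf p_l) (negPf q_l) !orbF.
move: la; rewrite -mulnA -subn_sqr Euclid_dvdM // => /orP[|//].
rewrite (Euclid_dvdM _ q) // (negPf q_l) orbF.
rewrite (Euclid_dvdM 4) // (negPf p_l) orbF.
by move/(lX 2)/l_neq2.
Qed.

(** The previous lemma applies to the generators p = k^2 + 2k and q = k^2 + k + 1: k even makes p +
    q odd, and 3 | k makes p and q coprime. *)
Lemma coprime_root_shifted j :
  coprime (root_shifted (6 * j)) (common_step (6 * j)).
Proof.
set k := 6 * j + 6.
have -> : common_step (6 * j) =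
    4 * (k ^ 2 + 2 * k) * (k ^ 2 + k + 1) * (k ^ 2 + 2 * k - (k ^ 2 + k + 1))
    * (k ^ 2 + 2 * k + (k ^ 2 + k + 1)).
  have -> : k ^ 2 + 2 * k - (k ^ 2 + k + 1) = 6 * j + 5 by rewrite /k; lia.
  by rewrite /common_step /k; ring.
apply: coprime_pythagorean.
- rewrite (_ : k ^ 2 + 2 * k = k * (k + 2)); last by ring.
  rewrite coprimeMl; apply/andP; split.
    rewrite (_ : k ^ 2 + k + 1 = (k + 1) * k + 1); last by ring.
    by rewrite /coprime gcdnMDl gcdn1.
  (* One division step leaves the remainder 3, which is coprime to k + 2 because 3 | k. *)
  rewrite (_ : k ^ 2 + k + 1 = (6 * j + 5) * (k + 2) + 3); last by rewrite /k; ring.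
  rewrite /coprime gcdnMDl -/(coprime _ _) coprime_sym prime_coprime //.
  by rewrite /k; lia.
- have odd_k : odd k = false by rewrite /k; lia.
  by clearbody k; rewrite !oddD !oddX odd_k.
- by rewrite /k; lia.
- by rewrite /root_shifted -/k; ring.
Qed.

Definition cube_steps (t : nat) (i : 'I_3) : nat :=
  if i < 2 then common_step t else shift_step t.

Lemma cube_steps_gt0 t i : 0 < cube_steps t i.
Proof.
by rewrite /cube_steps /common_step /shift_step /hyp1;
  case: ifP => _; rewrite !(muln_gt0, addn_gt0, expn_gt0) ?orbT.
Qed.

Lemma sum_cube_steps t (e : 'I_3 -> bool) :
  exists e0 e1 e2 : bool, \sum_(i < 3) e i * cube_steps t i =
    e0 * common_step t + e1 * common_step t + e2 * shift_step t.
Proof.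
rewrite !big_ord_recl big_ord0 /cube_steps /= addn0 addnA.
by do 3 eexists.
Qed.

(** The first two booleans only count steps along a progression, and the third selects the triangle,
    so the eight sums are the six terms of the two progressions. *)
Lemma cube_sub_squares t :
  (hilbert_cube (root_a0 t ^ 2) (cube_steps t) `<=` squares)%classic.
Proof.
move=> _ [e _ <-]; have [e0 [e1 [e2 ->]]] := sum_cube_steps t e.
have := (root_a0_step t, root_a0_step2 t, root_a0_shift t,
         root_shifted_step t, root_shifted_step2 t).
move=> [[[[E1 E2] E3] E4] E5].
case: e0 e1 e2 => [] [] []; rewrite !(mul1n, mul0n, addn0, add0n).
- by exists (root_max2 t) => //; lia.
- by exists (root_max1 t) => //; lia.
- by exists (hyp2 t) => //; lia.
- by exists (hyp1 t) => //; lia.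
- by exists (hyp2 t) => //; lia.
- by exists (hyp1 t) => //; lia.
- by exists (root_shifted t) => //; lia.
- by exists (root_a0 t).
Qed.

(** A common divisor of the entries divides a_0 + a_3, the first term of the second progression, as
    well as the common step, and these two are coprime. *)
Lemma cube_reduced j :
  reduced (root_a0 (6 * j) ^ 2) (cube_steps (6 * j)).
Proof.
rewrite /reduced !big_ord_recl big_ord0 /cube_steps /= gcdn0.
set g := gcdn _ _.
have : g %| gcdn (root_shifted (6 * j) ^ 2) (common_step (6 * j)).
  rewrite -root_a0_shift dvdn_gcd.
  have /and3P[ga0 ga gb] : [&& g %| root_a0 (6 * j) ^ 2,
      g %| common_step (6 * j) & g %| shift_step (6 * j)].
    have := dvdnn g; rewrite {2}/g !dvdn_gcd => /and4P[-> -> _ ->] //.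
  by rewrite dvdn_add.
have /eqP -> : coprime (root_shifted (6 * j) ^ 2) (common_step (6 * j)).
  by rewrite coprimeXl // coprime_root_shifted.
by rewrite dvdn1.
Qed.

(** The largest element of the cube is [root_max2] squared, and [root_max2] is at most (2k)^4 with k
    = 6(j + 1). *)
Lemma cube_max_le j :
  root_a0 (6 * j) ^ 2 + shift_step (6 * j) + 2 * common_step (6 * j)
    <= (12 * j.+1) ^ 8.
Proof.
rewrite root_a0_shift root_shifted_step2 -[8]/(4 * 2) expnM leq_exp2r //.
have -> : (12 * j.+1) ^ 4 = 16 * (6 * j + 6) ^ 4 by ring.
by rewrite /root_max2; set k := (X in X ^ 4); have : 6 <= k; nia.
Qed.

(** In the parameter t all coefficients are nonnegative, so the polynomial is strictly increasing.
    Thus a_0 alone tells the cubes apart. *)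
Lemma root_a0_inj : injective root_a0.
Proof.
have lt_root t u : t < u -> root_a0 t < root_a0 u.
  move=> lt_tu; rewrite /root_a0 ltn_add2r.
  rewrite -addnS leq_add ?(leq_pmul2l, ltn_pmul2l) //.
  have le_tu := ltnW lt_tu.
  by apply: leq_add; [apply: leq_add|]; rewrite ?leq_pmul2l // leq_exp2r.
move=> t u /eqP; case: (ltngtP t u) => // /lt_root lt_tu /eqP eq_tu;
  by rewrite eq_tu ltnn in lt_tu.
Qed.

Lemma Hcount3_ge N K : (12 * K) ^ 8 <= N -> K <= Hcount 3 N.
Proof.
move=> K_le.
pose cube (j : 'I_K) : 'I_N.+1 * {ffun 'I_3 -> 'I_N.+1} :=
  (inord (root_a0 (6 * j) ^ 2), [ffun i => inord (cube_steps (6 * j) i)]).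
(* [inord] would send a value above N to 0; bounding the largest element of the cube by N rules this
   out for every coordinate. *)
have max_le (j : 'I_K) :
    root_a0 (6 * j) ^ 2 + shift_step (6 * j) + 2 * common_step (6 * j) <= N.
  apply: leq_trans (cube_max_le j) (leq_trans _ K_le).
  by rewrite leq_exp2r // leq_pmul2l.
have a0_val (j : 'I_K) : (cube j).1 = root_a0 (6 * j) ^ 2 :> nat.
  by rewrite inordK // ltnS; apply: leq_trans (max_le j); rewrite -addnA leq_addr.
have steps_val (j : 'I_K) :
    (fun i => nat_of_ord ((cube j).2 i)) = cube_steps (6 * j).
  apply/funext => i; rewrite ffunE inordK // ltnS.
  apply: leq_trans (max_le j); rewrite /cube_steps.
  move: (root_a0 _ ^ 2) (shift_step _) (common_step _) => a0 b a.
  by case: ifP => _; lia.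
have cube_inj : injective cube.
  move=> j1 j2 /(congr1 (fun c => nat_of_ord c.1)); rewrite !a0_val.
  move=> /eqP; rewrite eqn_exp2r // => /eqP /root_a0_inj /eqP.
  by rewrite eqn_pmul2l // => /eqP /val_inj.
rewrite -[K in K <= _]card_ord -(card_codom cube_inj).
apply: subset_leq_card; apply/fintype.subsetP => _ /codomP[j ->].
rewrite inE; apply/and3P; split.
- apply/forallP => i; rewrite -[nat_of_ord _]/((fun i => nat_of_ord ((cube j).2 i)) i).
  by rewrite steps_val; apply: cube_steps_gt0.
- by rewrite steps_val a0_val cube_reduced.
- by apply/asboolP; rewrite steps_val a0_val; apply: cube_sub_squares.
Qed.
End Family.

Theorem theorem1p5 (R : realType) :
  exists c : R, 0 < c /\
    exists N0 : nat, forall N : nat, (0 < N)%N -> (N0 <= N)%N ->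
      c * N%:R `^ (1 / 8) <= (Hcount 3 N)%:R.
Proof.
(* For the largest K with (12K)^8 <= N, the bound K + 1 <= 2K gives N < (12(K + 1))^8 <= (24K)^8. *)
exists 24^-1; split; first by rewrite invr_gt0.
(* This threshold makes K = 1 admissible, so the largest K is positive. *)
exists (12 ^ 8)%N => N N_gt0 N0_le.
have exK : exists K : nat, ((12 * K) ^ 8 <= N)%N by exists 1%N; rewrite muln1.
have K_le K : ((12 * K) ^ 8 <= N)%N -> (K <= N)%N.
  case: K => // K; apply: leq_trans.
  apply: (leq_trans (leq_pmull K.+1 (isT : 0 < 12)%N)).
  by rewrite -[X in (X <= _)%N]expn1 leq_pexp2l ?muln_gt0.
have [K K_ok K_max] := ex_maxnP exK K_le.
have K_gt0 : (0 < K)%N by apply: K_max; rewrite muln1.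
have N_lt : (N < (12 * K.+1) ^ 8)%N.
  by rewrite ltnNge; apply/negP => /K_max; rewrite ltnn.
have root_le : N%:R `^ (1 / 8) <= (24 * K)%:R :> R.
  have -> : (24 * K)%:R = ((24 * K) ^ 8)%:R `^ (1 / 8) :> R.
    rewrite natrX -powR_mulrn // -powRrM mul1r mulfV ?pnatr_eq0 //.
    by rewrite powRr1.
  rewrite ge0_ler_powR ?nnegrE // ler_nat.
  apply: leq_trans (ltnW N_lt) _; rewrite leq_exp2r //.
  by move: K_gt0; clear; lia.
rewrite ler_pdivrMl //; apply: le_trans root_le _.
by rewrite -natrM ler_nat leq_mul2l /= Hcount3_ge.
Qed.
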